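(* Let $K$ be a simplicial complex on the vertex set $[m]=\{1,\dots,m\}$ whose $1$-skeleton is a chordal graph, and let $Y_1,\dots,Y_m$ be pointed $CW$-complexes. If $K^{f}$ is the flagification of $K$ then the map $f\colon(\underline{CY},\underline{Y})^{K}\to(\underline{CY},\underline{Y})^{K^{f}}$ induced by the simplicial inclusion $K\to K^f$ has a right homotopy inverse.
   Context: A simplicial complex $K$ on the vertex set $[m]$ is a collection of subsets of $[m]$ closed under taking subsets, containing $\varnothing$ and all singletons. It is flag if any set of vertices pairwise connected by edges spans a simplex; the flagification $K^f$ of $K$ is the minimal flag complex on $[m]$ containing $K$. A graph is chordal if each of its cycles with at least $4$ vertices has a chord (an edge joining two vertices not adjacent in the cycle). $CY_i$ is the (reduced) cone on $Y_i$, and $(\underline{CY},\underline{Y})^{K}=\bigcup_{\sigma\in K}\bigl(\prod_{i\in\sigma}CY_i\times\prod_{i\notin\sigma}Y_i\bigr)\subseteq\prod_{i=1}^m CY_i$. A right homotopy inverse of $f\colon A\to B$ is a map $s\colon B\to A$ with $f\circ s$ homotopic to the identity of $B$. *)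

(* Defs.v *)
From HB Require Import structures.
From mathcomp Require Import all_boot all_order all_algebra generic_quotient.
From mathcomp Require Import all_classical all_reals all_analysis.

Set Implicit Arguments.
Unset Strict Implicit.
Unset Printing Implicit Defensive.

Import Order.TTheory GRing.Theory Num.Theory.
Import numFieldNormedType.Exports.

(** * Simplicial complexes and graphs *)

Section SimplicialComplexes.
Local Open Scope set_scope.
Variable m : nat.
Implicit Types (K L : {set {set 'I_m}}) (s t : {set 'I_m}) (e : rel 'I_m).

Definition simplicial_complex K : bool :=
  [&& finset.set0 \in K,
      [forall v : 'I_m, finset.set1 v \in K]
    & [forall s in K, forall t : {set 'I_m}, (t \subset s) ==> (t \in K)]].

(** The edge relation of the 1-skeleton. *)
Definition skel1 K : rel 'I_m :=
  fun x y => (x != y) && ([set x; y]%SET \in K).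

Definition flag_complex K : bool :=
  simplicial_complex K &&
  [forall s : {set 'I_m},
     [forall x in s, forall y in s, (x != y) ==> skel1 K x y] ==> (s \in K)].

(** The intersection of all flag complexes containing [K]; by
    [flagificationP] it is the smallest of them when [K] is a complex. *)
Definition flagification K : {set {set 'I_m}} :=
  [set s | [forall L : {set {set 'I_m}},
              flag_complex L && (K \subset L) ==> (s \in L)]]%SET.

(** [ucycle e c] is a cyclic sequence of pairwise distinct vertices;
    [y != next c x] and [x != next c y] say that [x] and [y] are not
    adjacent on it. *)
Definition chordal e : Prop :=
  forall c : seq 'I_m, ucycle e c -> (4 <= size c)%N ->
  exists x y, [/\ x \in c, y \in c, e x y, y != next c x & x != next c y].

Lemma flagification_sup K : K \subset flagification K.
Proof.
apply/fintype.subsetP => s sK; rewrite inE; apply/forallP => L.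
by apply/implyP => /andP[_ /fintype.subsetP]; exact.
Qed.

Lemma flagificationP K : simplicial_complex K ->
  [/\ flag_complex (flagification K), K \subset flagification K
    & forall L, flag_complex L -> K \subset L -> flagification K \subset L].
Proof.
move=> /and3P[K0 /forallP K1 _].
have KF := flagification_sup K.
have min L : flag_complex L -> K \subset L -> flagification K \subset L.
  move=> fL KL; apply/fintype.subsetP => s; rewrite inE => /forallP/(_ L).
  by rewrite fL KL.
split=> //; apply/andP; split.
  apply/and3P; split.
  - exact: (fintype.subsetP KF).
  - by apply/forallP => v; exact: (fintype.subsetP KF).
  - apply/forall_inP => s sF; apply/forallP => t; apply/implyP => ts.
    rewrite inE; apply/forallP => L; apply/implyP => /andP[fL KL].
    have sL := fintype.subsetP (min L fL KL) s sF.
    case/andP: fL => /and3P[_ _ /forall_inP/(_ s sL)/forallP/(_ t)].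
    by rewrite ts.
apply/forallP => s; apply/implyP => /forall_inP sF.
rewrite inE; apply/forallP => L; apply/implyP => /andP[fL KL].
have FL := fintype.subsetP (min L fL KL).
case/andP: fL => _ /forallP/(_ s)/implyP; apply.
apply/forall_inP => x xs; apply/forall_inP => y ys; apply/implyP => xy.
move: (sF x xs) => /forall_inP/(_ y ys); rewrite xy /= /skel1 xy /=.
exact: FL.
Qed.

End SimplicialComplexes.

Local Open Scope classical_set_scope.
Local Open Scope ring_scope.

(** * Homotopies *)

Definition unit_interval (R : realType) : set R := `[0, 1].
Arguments unit_interval : clear implicits.

Lemma unit_interval0_subproof (R : realType) : (0 : R) \in unit_interval R.
Proof. by rewrite inE /unit_interval /= in_itv /= lexx ler01. Qed.

Lemma unit_interval1_subproof (R : realType) : (1 : R) \in unit_interval R.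
Proof. by rewrite inE /unit_interval /= in_itv /= lexx ler01. Qed.

Definition ui0 (R : realType) : unit_interval R :=
  exist _ 0 (unit_interval0_subproof R).
Definition ui1 (R : realType) : unit_interval R :=
  exist _ 1 (unit_interval1_subproof R).

(** Free (unpointed) homotopy. *)
Definition homotopic (R : realType) (A B : topologicalType) (f g : A -> B) :=
  exists H : A * unit_interval R -> B,
    [/\ continuous H, forall a, H (a, ui0 R) = f a
      & forall a, H (a, ui1 R) = g a].

Definition has_right_homotopy_inverse (R : realType) (A B : topologicalType)
    (f : A -> B) :=
  exists2 s : B -> A, continuous s & homotopic R (f \o s) idfun.

(** * CW-complexes *)

(** The Euclidean unit disk; the norm of the library on ['rV[R]_n] is the
    sup norm, which induces the same topology. *)
Definition disk (R : realType) (n : nat) : set 'rV[R]_n :=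
  [set x | \sum_(i < n) x ord0 i ^+ 2 <= 1].
Definition open_disk (R : realType) (n : nat) : set 'rV[R]_n :=
  [set x | \sum_(i < n) x ord0 i ^+ 2 < 1].
Definition sphere (R : realType) (n : nat) : set 'rV[R]_n :=
  [set x | \sum_(i < n) x ord0 i ^+ 2 = 1].
Arguments disk : clear implicits.
Arguments open_disk : clear implicits.
Arguments sphere : clear implicits.

Record cw_structure (R : realType) (X : topologicalType) := CWStructure {
  cell : Type;
  cell_dim : cell -> nat;
  char_map : forall c : cell, 'rV[R]_(cell_dim c) -> X;
  open_cell := fun c => @char_map c @` open_disk R (cell_dim c);
  closed_cell := fun c => @char_map c @` disk R (cell_dim c);
  cw_hausdorff : hausdorff_space X;
  char_map_continuous : forall c,
    {within disk R (cell_dim c), continuous (@char_map c)};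
  (** [char_map c] is a homeomorphism from the open disk to the open cell *)
  char_map_homeo : forall c,
    exists2 g : X -> 'rV[R]_(cell_dim c),
      {within open_cell c, continuous g}
      & {in open_disk R (cell_dim c), cancel (@char_map c) g};
  open_cell_disjoint : trivIset [set: cell] open_cell;
  open_cell_cover : \bigcup_c open_cell c = [set: X];
  cell_closure_finite : forall c,
    exists2 J : set cell,
      finite_set J /\ (forall d, J d -> (cell_dim d < cell_dim c)%N)
      & @char_map c @` sphere R (cell_dim c) `<=` \bigcup_(d in J) open_cell d;
  cw_weak_topology : forall A : set X,
    (forall c, closed (A `&` closed_cell c)) -> closed A }.

(** The base point of a pointed CW-complex is one of its vertices. *)
Record pointed_cw_structure (R : realType) (X : ptopologicalType) := PointedCW {
  pointed_cw :> cw_structure R X;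
  point_vertex : exists2 c : cell pointed_cw,
    cell_dim c = 0%N & open_cell c point }.

(** * Reduced cones *)

Section Cone.
Variables (R : realType) (Y : ptopologicalType).

(** The part of [Y * I] collapsed to the cone point. *)
Definition cone_collapsed (z : Y * unit_interval R) : bool :=
  (z.2 == ui0 R) || (z.1 == point).

Definition cone_rel0 (z w : Y * unit_interval R) : bool :=
  (z == w) || (cone_collapsed z && cone_collapsed w).

Lemma cone_rel_refl : reflexive cone_rel0.
Proof. by move=> z; rewrite /cone_rel0 eqxx. Qed.

Lemma cone_rel_sym : symmetric cone_rel0.
Proof. by move=> z w; rewrite /cone_rel0 eq_sym andbC. Qed.

Lemma cone_rel_trans : transitive cone_rel0.
Proof.
move=> w z v /predU1P[-> //|/andP[cz cw]] /predU1P[<-|/andP[_ cv]].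
  by rewrite /cone_rel0 cz cw orbT.
by rewrite /cone_rel0 cz cv orbT.
Qed.

Canonical cone_rel := EquivRel cone_rel0 cone_rel_refl cone_rel_sym cone_rel_trans.

Definition cone : Type := {eq_quot cone_rel}%qT.

HB.instance Definition _ := Topological.copy cone
  (quotient_topology {eq_quot cone_rel}%qT).
HB.instance Definition _ := Quotient.on cone.

Definition cone_pi (z : Y * unit_interval R) : cone := (\pi_cone z)%qT.

(** [Y] sits in [CY] at height 1, opposite to the cone point. *)
Definition cone_base (y : Y) : cone := cone_pi (y, ui1 R).

End Cone.

(** * Polyhedral products *)

Section PolyhedralProduct.
Variables (R : realType) (m : nat) (Y : 'I_m -> ptopologicalType).

(** The plain product topology, not its compactly generated refinement. *)
Definition cone_product := prod_topology (fun i : 'I_m => cone R (Y i)).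

Definition pp_block (s : {set 'I_m}) : set cone_product :=
  [set x | forall i : 'I_m, i \notin s -> range (@cone_base R (Y i)) (x i)].

Definition polyhedral_product (K : {set {set 'I_m}}) : set cone_product :=
  \bigcup_(s in [set` K]) pp_block s.

Lemma pp_incl_subproof (K L : {set {set 'I_m}}) (KL : K \subset L)
    (x : polyhedral_product K) : val x \in polyhedral_product L.
Proof.
apply/mem_set; have [s sK xs] := set_mem (valP x).
by exists s => //; exact: (fintype.subsetP KL).
Qed.

Definition pp_incl (K L : {set {set 'I_m}}) (KL : K \subset L)
    (x : polyhedral_product K) : polyhedral_product L :=
  exist _ (val x) (pp_incl_subproof KL x).

End PolyhedralProduct.

(* Main.v *)
Require Import Defs.
From mathcomp Require Import all_boot all_order all_algebra.
From mathcomp Require Import all_classical all_reals all_analysis.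
From mathcomp Require Import lra.

(** A stronger statement is true: the inclusion has a right homotopy inverse
    already on the polyhedral product of the discrete complex on the vertices,
    which every complex [K] contains. By [has_right_homotopy_inverse_factor] that
    is enough.

    A point of the product of the cones belongs to the polyhedral product of a
    complex when its coordinates off the base (outside the [Y i]) form a face. The
    flagification of [K] is the complex of cliques of the 1-skeleton of [K], and
    that graph is chordal, so by Dirac's theorem ([chordal_simplicial_vertex]) it
    has a simplicial vertex [v]: the neighbours of [v] form a clique [N]. Deform
    the polyhedral product as follows. Write the coordinate at [v] as [(y, t)].
    Stretch the middle of the cone over the whole cone and, as [t] approaches that
    middle, contract the coordinates in [N] to their cone points. When [v] is off
    the base all other coordinates off the base are in [N], so that the face
    [v |: N] contains everything that moves, and the deformation does not leave
    the polyhedral product. At its end no other coordinate is off the base when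
    that of [v] is, so [v] has become an isolated vertex
    ([pp_incl_isolate_simplicial_vertex]). The remaining vertices still span a
    chordal graph, and isolating them one after the other leads to the discrete
    complex ([clique_complex_right_inverse]).

    The cones are reduced: over the base point of [Y v] all heights [t] are
    identified, and the contraction of the coordinates in [N] has to be switched
    off there. This is where the CW-structure enters. The base point is
    nondegenerate ([pointed_cw_well_pointed]): there is a homotopy of [Y v] which
    moves a whole neighbourhood of the base point to the base point, so that within
    this neighbourhood the contraction may be turned down continuously. As for any
    subcomplex, this follows from a retraction of [X * I] onto [X * {0}] and
    [{point} * I] together, obtained by projecting radially in one cell after the
    other. *)

Set Implicit Arguments.
Unset Strict Implicit.
Unset Printing Implicit Defensive.

Import Order.TTheory GRing.Theory Num.Theory.
Import numFieldNormedType.Exports.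

Local Open Scope classical_set_scope.
Local Open Scope ring_scope.

(** * Point-set topology *)

Lemma continuous_pair (T U V : topologicalType) (f : T -> U) (g : T -> V) :
  continuous f -> continuous g -> continuous (fun x => (f x, g x)).
Proof. by move=> cf cg x; apply: cvg_pair; [exact: cf|exact: cg]. Qed.

Lemma continuous_compT (T U V : topologicalType) (g : U -> V) (f : T -> U) :
  continuous g -> continuous f -> continuous (fun x => g (f x)).
Proof. by move=> cg cf x; apply: continuous_comp; [exact: cf|exact: cg]. Qed.

Lemma continuous_fst (U V : topologicalType) : continuous (@fst U V).
Proof. by move=> x; exact: cvg_fst. Qed.

Lemma continuous_snd (U V : topologicalType) : continuous (@snd U V).
Proof. by move=> x; exact: cvg_snd. Qed.

Lemma continuous_id (U : topologicalType) : continuous (fun x : U => x).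
Proof. by move=> x; exact: cvg_id. Qed.

Lemma continuous_cst (T U : topologicalType) (a : U) : continuous (fun _ : T => a).
Proof. by move=> x; exact: cvg_cst. Qed.

Lemma continuous_set_val (U : topologicalType) (A : set U) :
  continuous (set_val : A -> U).
Proof. exact: initial_continuous. Qed.

Lemma continuous_to_set (T U : topologicalType) (A : set U) (f : T -> A) :
  continuous (fun x => set_val (f x)) -> continuous f.
Proof. by move=> cf; apply: continuous_comp_initial. Qed.

Lemma continuous_prod_topology (T : topologicalType) (I : eqType)
    (K : I -> topologicalType) (f : T -> prod_topology K) :
  (forall i, continuous (fun x => f x i)) -> continuous f.
Proof.
move=> cf x; apply/cvg_sup => i.
have ci : continuous (f : T -> initial_topology (fun g : (forall i, K i) => g i)).
  by apply: continuous_comp_initial; exact: cf.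
exact: ci.
Qed.

Lemma closed_preimage (T U : topologicalType) (f : T -> U) (A : set U) :
  continuous f -> closed A -> closed (f @^-1` A).
Proof. by move=> /continuous_closedP; exact. Qed.

Lemma continuous_if_closed (T U : topologicalType) (A B : set T)
    (f g : T -> U) (h : T -> U) :
  closed A -> closed B -> A `|` B = setT ->
  continuous f -> continuous g ->
  (forall x, A x -> h x = f x) -> (forall x, B x -> h x = g x) ->
  continuous h.
Proof.
move=> cA cB AB /continuous_closedP cf /continuous_closedP cg hf hg.
apply/continuous_closedP => C cC.
have -> : h @^-1` C = (A `&` f @^-1` C) `|` (B `&` g @^-1` C).
  apply/seteqP; split => x /=.
    move=> hC; have : [set: T] x by [].
    by rewrite -AB => -[Ax|Bx]; [left; rewrite -hf|right; rewrite -hg].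
  by move=> [[Ax]|[Bx]]; [rewrite hf|rewrite hg].
by apply: closedU; apply: closedI => //; [exact: cf|exact: cg].
Qed.

Lemma set_type_compact (U : topologicalType) (A : set U) :
  compact A -> compact [set: A].
Proof.
move=> cA F FF _.
have FA : (set_val @ F) A.
  by apply: (@filterS _ F _ setT) => [[x xA] _ /=|];
    [exact/set_mem|exact: filterT].
have [x [Ax clx]] := cA _ (fmap_proper_filter _ FF) FA.
exists (exist _ x (mem_set Ax)); split=> // P Q FP [_ [[W oW <-]] /= Wx WQ].
have FP' : (set_val @ F) (set_val @` P).
  by apply: (@filterS _ F _ P) => // y Py; exists y.
have [_ [[y Py <-] Wy]] := clx _ _ FP' (open_nbhs_nbhs (conj oW Wx)).
by exists y; split=> //; exact: WQ.
Qed.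

Lemma set_type_hausdorff (U : topologicalType) (A : set U) :
  hausdorff_space U -> hausdorff_space A.
Proof.
move=> hU x y cxy; apply: val_inj; apply: hU => P Q nP nQ.
have [z [Pz Qz]] := cxy _ _ (@continuous_set_val U A x P nP)
  (@continuous_set_val U A y Q nQ).
by exists (set_val z).
Qed.

Lemma compact_setXT (U V : topologicalType) :
  compact [set: U] -> compact [set: V] -> compact [set: U * V].
Proof. by move=> cU cV; rewrite -setXTT; exact: compact_setX. Qed.

Lemma setX_hausdorff (U V : topologicalType) :
  hausdorff_space U -> hausdorff_space V -> hausdorff_space (U * V)%type.
Proof.
move=> hU hV [a b] [c d] cl; congr pair.
  apply: hU => P Q nP nQ.
  have nP' : nbhs (a, b) (fst @^-1` P) by exact: (@continuous_fst U V (a, b)).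
  have nQ' : nbhs (c, d) (fst @^-1` Q) by exact: (@continuous_fst U V (c, d)).
  by have [z [Pz Qz]] := cl _ _ nP' nQ'; exists z.1.
apply: hV => P Q nP nQ.
have nP' : nbhs (a, b) (snd @^-1` P) by exact: (@continuous_snd U V (a, b)).
have nQ' : nbhs (c, d) (snd @^-1` Q) by exact: (@continuous_snd U V (c, d)).
by have [z [Pz Qz]] := cl _ _ nP' nQ'; exists z.2.
Qed.

Lemma closed_equalizer (T U : topologicalType) (f g : T -> U) :
  hausdorff_space U -> continuous f -> continuous g ->
  closed [set x | f x = g x].
Proof.
move=> hU cf cg x clx; apply: hU => P Q nP nQ.
have nPQ : nbhs x ((f @^-1` P) `&` (g @^-1` Q)).
  by apply: filterI; [exact: cf|exact: cg].
have [z [/= fg [Pz Qz]]] := clx _ nPQ.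
by exists (f z); split=> //; rewrite fg.
Qed.

Lemma closed_image_compact (T U : topologicalType) (f : T -> U) (A : set T) :
  compact [set: T] -> hausdorff_space U -> continuous f -> closed A ->
  closed (f @` A).
Proof.
move=> cT hU cf cA; apply: compact_closed => //.
apply: continuous_compact; first exact: continuous_subspaceT.
exact: subclosed_compact cT _.
Qed.

(** The tube lemma, which holds because compact sets are near-covering. *)
Lemma tube_open (X I : topologicalType) (V : set I) (O : set (X * I)) :
  compact V -> open O -> open [set x | forall t, V t -> O (x, t)].
Proof.
move=> cV oO; rewrite openE => x Ox /=.
move/compact_near_coveringP: cV => /(_ X (nbhs x) (fun y t => O (y, t)) _) H.
have H' : forall t, V t -> \forall t' \near t & y \near nbhs x, O (y, t').
  move=> t /Ox Oxt; move: oO; rewrite openE => /(_ _ Oxt) [[P Q] [/= Px Qt] PQ].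
  by exists (Q, P) => // -[t' y] [/= Qt' Py]; exact: PQ.
exact: (H H').
Qed.

(** A map out of [X * I] may be tested on the pieces [T_ j * I] whenever [X]
    carries the final topology of the maps [g j], because [I] is locally
    compact: a point [(x0, t0)] sent into [U] has a compact time neighbourhood
    [V] with [F (x0, V)] inside [U], and the points whose whole [V]-track stays
    in [U] form a set that the tube lemma shows to be open on each piece. It is
    used for the weak topology of a CW-complex and for the quotient topology of
    a cone; neither space need be locally compact itself. *)
Lemma test_maps_prod_continuous (J : Type) (T_ : J -> topologicalType)
    (X I Z : topologicalType) (g : forall j, T_ j -> X) (F : X * I -> Z) :
  compact [set: I] -> hausdorff_space I ->
  (forall W : set X, (forall j, open (g j @^-1` W)) -> open W) ->
  (forall x, exists j z, g j z = x) ->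
  (forall j, continuous (fun p : T_ j * I => F (g j p.1, p.2))) ->
  continuous F.
Proof.
move=> cI hI testg surjg cF; apply/continuousP => U oU.
rewrite openE => -[x0 t0] /= FU.
have [j0 [z0 gz0]] := surjg x0.
have nV : nbhs t0 [set t | U (F (x0, t))].
  have ct : continuous (fun t => F (g j0 z0, t)).
    apply: (continuous_compT (cF j0) (f := fun t => (z0, t))).
    by apply: continuous_pair; [move=> ?; exact: cvg_cst|exact: continuous_id].
  have -> : [set t | U (F (x0, t))] = (fun t => F (g j0 z0, t)) @^-1` U.
    by rewrite gz0.
  by apply: ct; apply: open_nbhs_nbhs; rewrite gz0.
have [V nV' VU] := compact_regular hI cI filterT nV.
have cV : compact (closure V).
  by apply: subclosed_compact cI _ => //; exact: closed_closure.
pose W := [set x | forall t, closure V t -> U (F (x, t))].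
have oW : open W.
  apply: testg => j.
  have oO : open [set p : T_ j * I | U (F (g j p.1, p.2))].
    by have /continuousP := cF j; exact.
  exact: (tube_open cV oO).
exists (W, V) => /=; last first.
  by move=> [x t] [/= Wx Vt]; apply: Wx; exact: subset_closure.
by split=> //; apply: open_nbhs_nbhs; split=> // t /VU.
Qed.

(** * The unit interval and the Euclidean norm *)

Section RealFunctions.
Variables (R : realType) (T : topologicalType).
Implicit Types f g : T -> R.

Lemma continuous_add f g :
  continuous f -> continuous g -> continuous (fun x => f x + g x).
Proof. by move=> cf cg x; apply: cvgD; [exact: cf|exact: cg]. Qed.

Lemma continuous_sub f g :
  continuous f -> continuous g -> continuous (fun x => f x - g x).
Proof. by move=> cf cg x; apply: cvgB; [exact: cf|exact: cg]. Qed.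

Lemma continuous_mul f g :
  continuous f -> continuous g -> continuous (fun x => f x * g x).
Proof. by move=> cf cg x; apply: cvgM; [exact: cf|exact: cg]. Qed.

Lemma continuous_maxr f g :
  continuous f -> continuous g -> continuous (fun x => Num.max (f x) (g x)).
Proof. by move=> cf cg x; apply: continuous_max; [exact: cf|exact: cg]. Qed.

Lemma continuous_minr f g :
  continuous f -> continuous g -> continuous (fun x => Num.min (f x) (g x)).
Proof. by move=> cf cg x; apply: continuous_min; [exact: cf|exact: cg]. Qed.

End RealFunctions.

Section UnitInterval.
Variable R : realType.
Local Notation I := (unit_interval R).

Lemma unit_interval_compact : compact [set: I].
Proof. by apply: set_type_compact; exact: segment_compact. Qed.

Lemma unit_interval_hausdorff : hausdorff_space I.
Proof. by apply: set_type_hausdorff; exact: Rhausdorff. Qed.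

Lemma unit_interval_bounds (t : I) : 0 <= set_val t <= 1.
Proof.
have := set_mem (valP t).
by rewrite /unit_interval /= in_itv /=.
Qed.

Lemma clamp_subproof (x : R) : Num.max 0 (Num.min 1 x) \in unit_interval R.
Proof.
rewrite inE /unit_interval /= in_itv /= le_max lexx /= ge_max ler01 /=.
by rewrite ge_min lexx.
Qed.

(** The retraction of the line onto the unit interval; it lets homotopy
    parameters be written as real expressions. *)
Definition clamp (x : R) : I :=
  exist (fun y => y \in unit_interval R) _ (clamp_subproof x).

Lemma clamp_id (x : R) : 0 <= x <= 1 -> set_val (clamp x) = x.
Proof.
by move=> /andP[x0 x1]; rewrite set_valE /= (min_idPr x1) (max_idPr x0).
Qed.

Lemma clamp_val (t : I) : clamp (set_val t) = t.
Proof. by apply: val_inj; rewrite -!set_valE clamp_id// unit_interval_bounds. Qed.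

Lemma set_val_ui0 : set_val (ui0 R) = 0. Proof. by []. Qed.

Lemma set_val_ui1 : set_val (ui1 R) = 1. Proof. by []. Qed.

Lemma clamp0 : clamp 0 = ui0 R.
Proof. by apply: val_inj; rewrite -!set_valE clamp_id ?lexx ?ler01. Qed.

Lemma clamp1 : clamp 1 = ui1 R.
Proof. by apply: val_inj; rewrite -!set_valE clamp_id ?lexx ?ler01. Qed.

Lemma clamp_le0 (x : R) : x <= 0 -> clamp x = ui0 R.
Proof.
move=> x0; apply: val_inj; rewrite /= (min_idPr _) ?(le_trans x0)//.
exact/max_idPl.
Qed.

Lemma clamp_ge1 (x : R) : 1 <= x -> clamp x = ui1 R.
Proof.
move=> x1; apply: val_inj; rewrite /= (min_idPl x1).
exact/max_idPr.
Qed.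

Lemma continuous_clamp (T : topologicalType) (f : T -> R) :
  continuous f -> continuous (fun x => clamp (f x)).
Proof.
move=> cf; apply: continuous_to_set; rewrite set_valE /=.
apply: continuous_maxr; first exact: continuous_cst.
by apply: continuous_minr; first exact: continuous_cst.
Qed.

End UnitInterval.

Section EuclideanNorm.
Variables (R : realType) (n : nat).
Implicit Types v : 'rV[R]_n.

Definition enorm v : R := Num.sqrt (\sum_(i < n) v ord0 i ^+ 2).

Lemma enorm_ge0 v : 0 <= enorm v. Proof. exact: sqrtr_ge0. Qed.

Let sum_ge0 v : 0 <= \sum_(i < n) v ord0 i ^+ 2.
Proof. by apply: sumr_ge0 => i _; exact: sqr_ge0. Qed.

Lemma enorm_sqr v : enorm v ^+ 2 = \sum_(i < n) v ord0 i ^+ 2.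
Proof. by rewrite sqr_sqrtr. Qed.

Lemma disk_enorm v : disk R n v <-> enorm v <= 1.
Proof. by rewrite /disk /= -enorm_sqr expr_le1 ?enorm_ge0. Qed.

Lemma open_disk_enorm v : open_disk R n v <-> enorm v < 1.
Proof. by rewrite /open_disk /= -enorm_sqr expr_lt1 ?enorm_ge0. Qed.

Lemma sphere_enorm v : sphere R n v <-> enorm v = 1.
Proof.
rewrite /sphere /= -enorm_sqr; split=> [/eqP|->]; last by rewrite expr1n.
by rewrite sqrp_eq1 ?enorm_ge0 // => /eqP.
Qed.

Lemma enormZ a v : enorm (a *: v) = `|a| * enorm v.
Proof.
rewrite /enorm -sqrtr_sqr -sqrtrM ?sqr_ge0 // mulr_sumr; congr Num.sqrt.
by apply: eq_bigr => i _; rewrite mxE exprMn.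
Qed.

Lemma enorm_continuous : continuous enorm.
Proof.
apply: (continuous_compT (@sqrt_continuous R)).
have cadd : continuous (fun x : R * R => x.1 + x.2) by exact: add_continuous.
apply: (continuous_big cadd (F := fun i (v : 'rV[R]_n) => v ord0 i ^+ 2)) => i _.
by apply: continuous_mul; exact: coord_continuous.
Qed.

Lemma disk_compact : compact (disk R n).
Proof.
apply: (@subclosed_compact _ _
  [set v : 'rV[R]_n | forall i, `[-1, 1]%classic (v ord0 i)]).
- have -> : disk R n = enorm @^-1` [set x | x <= 1].
    by apply/seteqP; split=> v /disk_enorm.
  by have /continuous_closedP := enorm_continuous; apply; exact: closed_le.
- apply: (@rV_compact R n (fun=> (`[-1, 1]%classic : set R))) => _.
  exact: segment_compact.
move=> v vD i; rewrite /= in_itv /= -ler_norml -(@expr_le1 _ 2) //.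
rewrite real_normK ?num_real //; apply: le_trans vD.
by rewrite (bigD1 i) //= lerDl sumr_ge0// => j _; exact: sqr_ge0.
Qed.

End EuclideanNorm.

(** * The base point of a pointed CW-complex is nondegenerate *)

Section RadialPush.
Variables (R : realType) (n : nat).
Local Notation I := (unit_interval R).
Implicit Types (v : 'rV[R]_n) (t : I).

(** [push] and [push_height] are the two components of the projection of the
    cylinder [D^n * I] from the point [(0, 2)] onto its bottom and its side. The
    ray through [(v, t)] leaves the cylinder where [v] has been divided by
    [push_scale v t]: through the side when the norm is the larger of the two
    terms, through the bottom otherwise. *)
Definition push_scale v t : R := Num.max (enorm v) (1 - set_val t / 2).

Definition push v t : 'rV[R]_n := (push_scale v t)^-1 *: v.

Definition push_height v t : I := clamp (2 - (2 - set_val t) / push_scale v t).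

Lemma push_scale_gt0 v t : 0 < push_scale v t.
Proof.
by have := unit_interval_bounds t; rewrite /push_scale lt_max => tI; apply/orP;
  right; lra.
Qed.

Lemma push_disk v t : disk R n (push v t).
Proof.
apply/disk_enorm; rewrite enormZ normfV (gtr0_norm (push_scale_gt0 v t)).
by rewrite ler_pdivrMl ?push_scale_gt0// mulr1 /push_scale le_max lexx.
Qed.

Lemma push_bottom_or_sphere v t :
  push_height v t = ui0 R \/ sphere R n (push v t).
Proof.
have tI := unit_interval_bounds t.
rewrite /push_height /push; have s0 := push_scale_gt0 v t.
have [vt|tv] := leP (enorm v) (1 - set_val t / 2).
  left; apply: clamp_le0.
  have -> : push_scale v t = 1 - set_val t / 2 by apply/max_idPr.
  by rewrite subr_le0 ler_pdivlMr; lra.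
right; apply/sphere_enorm; rewrite enormZ normfV (gtr0_norm s0).
have E : push_scale v t = enorm v by apply/max_idPl/ltW.
by rewrite -E mulVf// gt_eqF.
Qed.

Lemma push_scale_fixed v t : t = ui0 R /\ disk R n v \/ sphere R n v ->
  push_scale v t = 1.
Proof.
have tI := unit_interval_bounds t; rewrite /push_scale.
move=> [[-> /disk_enorm v1]|/sphere_enorm ->].
  by rewrite set_valE /= mul0r subr0; apply/max_idPr.
by apply/max_idPl; lra.
Qed.

Lemma push_fixed v t : t = ui0 R /\ disk R n v \/ sphere R n v ->
  push v t = v /\ push_height v t = t.
Proof.
move=> /push_scale_fixed s1; rewrite /push /push_height s1 invr1 scale1r.
split=> //; rewrite -[RHS]clamp_val; congr clamp.
by rewrite mulr1; lra.
Qed.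

Lemma push_scale_continuous : continuous (fun p : 'rV[R]_n * I =>
  push_scale p.1 p.2).
Proof.
apply: continuous_maxr.
  exact: (continuous_compT (@enorm_continuous R n) (@continuous_fst _ _)).
apply: continuous_sub; first exact: continuous_cst.
apply: continuous_mul; last exact: continuous_cst.
exact: (continuous_compT (@continuous_set_val _ I) (@continuous_snd _ _)).
Qed.

Lemma push_scaleV_continuous : continuous (fun p : 'rV[R]_n * I =>
  (push_scale p.1 p.2)^-1).
Proof.
move=> p; apply: cvgV; first by rewrite gt_eqF// push_scale_gt0.
exact: push_scale_continuous.
Qed.

Lemma push_continuous : continuous (fun p : 'rV[R]_n * I => push p.1 p.2).
Proof.
move=> p; apply: cvgZ; first exact: push_scaleV_continuous.
exact: continuous_fst.
Qed.

Lemma push_height_continuous : continuous (fun p : 'rV[R]_n * I =>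
  push_height p.1 p.2).
Proof.
apply: continuous_clamp; apply: continuous_sub; first exact: continuous_cst.
apply: continuous_mul; last exact: push_scaleV_continuous.
apply: continuous_sub; first exact: continuous_cst.
exact: (continuous_compT (@continuous_set_val _ I) (@continuous_snd _ _)).
Qed.

End RadialPush.

(** What a nondegenerate base point provides: a pointed homotopy [h] from the
    identity that swallows at time [1] a neighbourhood of the base point, namely
    the one where the continuous weight [w] is positive. *)
Definition well_pointed (R : realType) (X : ptopologicalType) :=
  exists (h : X * unit_interval R -> X) (w : X -> unit_interval R),
    [/\ continuous h, continuous w, (forall x, h (x, ui0 R) = x),
        (forall t, h (point, t) = point)
      & w point = ui1 R /\ forall x, w x = ui0 R \/ h (x, ui1 R) = point].

Section CWPointed.
Variables (R : realType) (X : ptopologicalType) (S : pointed_cw_structure R X).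
Local Notation I := (unit_interval R).
Local Notation dim := (@cell_dim R X S).
Local Notation Phi := (@char_map R X S _).
Local Notation cells := (@cell R X S).
Local Notation D c := (disk R (dim c)).

Lemma cell_coordinates_exist (x : X) :
  exists p : {c : cells & 'rV[R]_(dim c)},
    open_disk R _ (projT2 p) /\ Phi (projT2 p) = x.
Proof.
have : [set: X] x by []; rewrite -(open_cell_cover S) => -[c _ [v vD vx]].
by exists (existT _ c v).
Qed.

(** The open cell that contains [x], with the coordinates of [x] in it. *)
Definition coord (x : X) := projT1 (cid (cell_coordinates_exist x)).

Lemma coordP x : open_disk R _ (projT2 (coord x)) /\ Phi (projT2 (coord x)) = x.
Proof. exact: projT2 (cid (cell_coordinates_exist x)). Qed.

Lemma coord_char_map c (v : 'rV[R]_(dim c)) : open_disk R _ v ->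
  coord (Phi v) = existT _ c v.
Proof.
move=> vD; have [] := coordP (Phi v); case: (coord _) => d w /= wD wv.
have dc : d = c.
  apply: (open_cell_disjoint (c0 := S)) => //.
  by exists (Phi v); split; [exists w|exists v].
subst d; congr existT; have [g _ gK] := @char_map_homeo _ _ S c.
by rewrite -(gK v) ?inE// -(gK w) ?inE// wv.
Qed.

Definition cell_dimension x := dim (projT1 (coord x)).

(** The projection [push], applied in the cell of the first component. It is
    discontinuous, since a point of a boundary sphere is moved in its own cell;
    but its iterates stabilise to a continuous map, [cell_retract]. *)
Definition cell_push (p : X * I) : X * I :=
  if p.1 == point then p
  else (Phi (push (projT2 (coord p.1)) p.2), push_height (projT2 (coord p.1)) p.2).

Lemma cell_push_bottom x : cell_push (x, ui0 R) = (x, ui0 R).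
Proof.
rewrite /cell_push /=; case: ifP => // _; have [oD xE] := coordP x.
have [|-> ->] := @push_fixed R _ (projT2 (coord x)) (ui0 R); last by rewrite xE.
by left; split=> //; apply: ltW.
Qed.

Lemma char_map_sphere c (v : 'rV[R]_(dim c)) : sphere R _ v ->
  (cell_dimension (Phi v) < dim c)%N.
Proof.
move=> vS; have [J [_ Jd] /(_ (Phi v))] := @cell_closure_finite _ _ S c.
case; first by exists v.
by move=> d /[dup] /Jd dc Jd' [w wD <-]; rewrite /cell_dimension coord_char_map.
Qed.

(** Why the iteration stops: a push ends at the bottom, or on a boundary sphere
    and hence in a cell of smaller dimension. *)
Lemma cell_push_cases p : [\/ p.1 = point, (cell_push p).2 = ui0 R
  | (cell_dimension (cell_push p).1 < cell_dimension p.1)%N].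
Proof.
have [->|p0] := eqVneq p.1 point; first by constructor 1.
rewrite /cell_push (negbTE p0) /=.
have [H|H] := push_bottom_or_sphere (projT2 (coord p.1)) p.2.
  by constructor 2.
by constructor 3; exact: char_map_sphere.
Qed.

Lemma cell_push_point t : cell_push (point, t) = (point, t).
Proof. by rewrite /cell_push eqxx. Qed.

Lemma iter_cell_push_fixed n p : cell_push p = p -> iter n cell_push p = p.
Proof. by move=> pE; elim: n => //= n ->. Qed.

Lemma cell_push_stable n p : (cell_dimension p.1 < n)%N ->
  cell_push (iter n cell_push p) = iter n cell_push p.
Proof.
elim: n p => // n IH p pn; rewrite iterSr.
have fixedE : cell_push (cell_push p) = cell_push p ->
    cell_push (iter n cell_push (cell_push p)) = iter n cell_push (cell_push p).
  by move=> E; rewrite iter_cell_push_fixed.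
have [p0|p0|plt] := cell_push_cases p.
- by apply: fixedE; case: p p0 pn => x t /= -> _; rewrite !cell_push_point.
- by apply: fixedE; case: (cell_push p) p0 => x t /= ->; exact: cell_push_bottom.
- by apply: IH; exact: leq_trans plt pn.
Qed.

(** The retraction of [X * I] onto [X * {0}] and [{point} * I] together. *)
Definition cell_retract (p : X * I) : X * I :=
  iter (cell_dimension p.1).+1 cell_push p.

Lemma iter_cell_push_retract n p : (cell_dimension p.1 < n)%N ->
  iter n cell_push p = cell_retract p.
Proof.
move=> pn; rewrite -(subnK pn) iterD iter_cell_push_fixed//.
exact: cell_push_stable.
Qed.

Lemma cell_retract_push p : cell_retract (cell_push p) = cell_retract p.
Proof.
pose N := maxn (cell_dimension p.1).+1 (cell_dimension (cell_push p).1).+1.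
rewrite -(@iter_cell_push_retract N) ?leq_maxr// -iterSr.
by rewrite iter_cell_push_retract// ltnS ltnW// leq_maxl.
Qed.

Lemma cell_retract_fixed p : cell_push p = p -> cell_retract p = p.
Proof. exact: iter_cell_push_fixed. Qed.

Lemma cell_retract_image p :
  (cell_retract p).2 = ui0 R \/ (cell_retract p).1 = point.
Proof.
have E : cell_push (cell_retract p) = cell_retract p.
  exact: cell_push_stable.
have := cell_push_cases (cell_retract p); rewrite E => -[|H|]; first by right.
  by left.
by rewrite ltnn.
Qed.

Lemma char_map_set_continuous c :
  continuous (fun v : D c => Phi (set_val v)).
Proof. exact/subspace_sigL_continuousP/char_map_continuous. Qed.

(** In the cell of the base point nothing is to be pushed, and in no other cell
    is the exception made for the base point in [cell_push] met. *)
Lemma char_map_point_cases c :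
  dim c = 0%N /\ (forall v : 'rV[R]_(dim c), Phi v = point) \/
  (forall v : 'rV[R]_(dim c), open_disk R _ v -> Phi v != point).
Proof.
have [c0 c00 [v0 v0D v0E]] := point_vertex S.
have [E|E] := pselect (c0 = c); [left|right].
  subst c0; split=> // v; rewrite -v0E; congr (Phi _).
  by apply/matrixP => i [j jlt]; exfalso; move: jlt; rewrite c00.
move=> v vD; apply/eqP => vE; apply: E.
apply: (open_cell_disjoint (c0 := S)) => //.
by exists point; split; [exists v0|exists v].
Qed.

Lemma cell_retract_char_map c (v : 'rV[R]_(dim c)) t :
  (forall v : 'rV[R]_(dim c), open_disk R _ v -> Phi v != point) ->
  disk R _ v ->
  cell_retract (Phi v, t) = cell_retract (Phi (push v t), push_height v t).
Proof.
move=> cN vD.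
have : enorm v < 1 \/ enorm v = 1.
  by move/disk_enorm: vD; rewrite le_eqVlt => /orP[/eqP|]; [right|left].
move=> [/open_disk_enorm vO|/sphere_enorm vS].
  rewrite -(cell_retract_push (Phi v, t)) /cell_push /= (negbTE (cN _ vO)).
  by rewrite coord_char_map.
by have [|-> ->] := @push_fixed R _ v t; first by right.
Qed.

Lemma disk_subtype_compact c : compact [set: D c].
Proof. by apply: set_type_compact; exact: disk_compact. Qed.

Lemma disk_subtype_hausdorff c : hausdorff_space (D c).
Proof. by apply: set_type_hausdorff; exact: norm_hausdorff. Qed.

(** Induction on the dimension of the cell. On [D c * I] the retraction factors
    through [push], so the preimage of a closed set [Z] is pulled back from the
    bottom, where the retraction is the identity, and from the side. The side is
    mapped into finitely many cells [j] of smaller dimension, and its part over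
    [j] is the projection, along the compact disk of [j], of a set which is
    closed by the induction hypothesis. *)
Lemma cell_retract_char_map_continuous c :
  continuous (fun p : D c * I => cell_retract (Phi (set_val p.1), p.2)).
Proof.
move: {2}(dim c).+1 (ltnSn (dim c)) => n.
elim: n c => // n IH c; rewrite ltnS => cn.
have [[_ c0]|cN] := char_map_point_cases c.
  have -> : (fun p : D c * I => cell_retract (Phi (set_val p.1), p.2)) =
      (fun p => (point, p.2)).
    by apply/funext => p; rewrite c0 cell_retract_fixed ?cell_push_point.
  by apply: continuous_pair; [exact: continuous_cst|exact: continuous_snd].
pose G (p : D c * I) := cell_retract (Phi (set_val p.1), p.2).
pose Q (p : D c * I) : D c * I :=
  (exist (fun v => v \in D c) _ (mem_set (push_disk (set_val p.1) p.2)),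
   push_height (set_val p.1) p.2).
have cval : continuous (fun p : D c * I => (set_val p.1, p.2)).
  apply: continuous_pair; last exact: continuous_snd.
  exact: (continuous_compT (@continuous_set_val _ _) (@continuous_fst _ _)).
have cQ : continuous Q.
  apply: continuous_pair.
    apply: continuous_to_set; rewrite set_valE /=.
    exact: (continuous_compT (@push_continuous _ _) cval).
  exact: (continuous_compT (@push_height_continuous _ _) cval).
have GQ p : G p = G (Q p).
  by rewrite /G (cell_retract_char_map _ cN)//; exact/set_mem/valP.
apply/continuous_closedP => Z cZ.
pose Z0 := [set p : D c * I | p.2 = ui0 R /\ Z (Phi (set_val p.1), ui0 R)].
have [J [finJ Jlt] SJ] := @cell_closure_finite _ _ S c.
pose E j := [set p : (D c * I) * D j | [/\ sphere R _ (set_val p.1.1),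
  Phi (set_val p.1.1) = Phi (set_val p.2) &
  Z (cell_retract (Phi (set_val p.2), p.1.2))]].
have cE j : J j -> closed (fst @` E j).
  move=> Jj; apply: closed_image_compact.
  - apply: compact_setXT; last exact: disk_subtype_compact.
    apply: compact_setXT; first exact: disk_subtype_compact.
    exact: unit_interval_compact.
  - apply: setX_hausdorff; first exact: disk_subtype_hausdorff.
    exact: unit_interval_hausdorff.
  - exact: continuous_fst.
  have c11 : continuous (fun p : (D c * I) * D j => p.1.1).
    exact: (continuous_compT (@continuous_fst _ _) (@continuous_fst _ _)).
  have -> : E j = [set p | enorm (set_val p.1.1) = 1] `&`
     ([set p | Phi (set_val p.1.1) = Phi (set_val p.2)] `&`
      (fun p => cell_retract (Phi (set_val p.2), p.1.2)) @^-1` Z).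
    apply/seteqP; split=> p /=.
      by move=> [/sphere_enorm ? ? ?].
    by move=> [/sphere_enorm ? [? ?]].
  apply: closedI.
    apply: closed_equalizer; [exact: Rhausdorff| |exact: continuous_cst].
    apply: (continuous_compT (@enorm_continuous _ _)).
    exact: (continuous_compT (@continuous_set_val _ _) c11).
  apply: closedI.
    apply: closed_equalizer; first exact: (cw_hausdorff S).
      exact: (continuous_compT (@char_map_set_continuous c) c11).
    exact: (continuous_compT (@char_map_set_continuous j) (@continuous_snd _ _)).
  have cj := IH j (leq_trans (Jlt _ Jj) cn).
  apply: closed_preimage => //.
  apply: (continuous_compT cj (f := fun p : (D c * I) * D j => (p.2, p.1.2))).
  apply: continuous_pair; first exact: continuous_snd.
  exact: (continuous_compT (@continuous_snd _ _) (@continuous_fst _ _)).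
have cZ0 : closed Z0.
  have -> : Z0 = [set p | p.2 = ui0 R] `&`
     (fun p => (Phi (set_val p.1), ui0 R)) @^-1` Z by [].
  apply: closedI.
    apply: closed_equalizer; first exact: unit_interval_hausdorff.
      exact: continuous_snd.
    exact: continuous_cst.
  apply: closed_preimage => //.
  apply: continuous_pair; last exact: continuous_cst.
  exact: (continuous_compT (@char_map_set_continuous c) (@continuous_fst _ _)).
pose Z1 := \bigcup_(j in J) (fst @` E j).
have cZ1 : closed Z1.
  (* A finite union over cells, whose type is not given a choice structure. *)
  exact: (@closed_bigcup _ {classic cells} J (fun j => fst @` E j)).
have -> : (fun p : D c * I => cell_retract (Phi (set_val p.1), p.2)) @^-1` Z =
    Q @^-1` (Z0 `|` Z1).
  apply/seteqP; split=> p /=; rewrite -/(G p) GQ.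
    have [H|H] := push_bottom_or_sphere (set_val p.1) p.2.
      rewrite /G /= H cell_retract_fixed ?cell_push_bottom// => Zp.
      by left; rewrite /Z0 /=.
    move=> Zp; right.
    have [|j Jj [w wD wE]] := SJ (Phi (push (set_val p.1) p.2)).
      by exists (push (set_val p.1) p.2).
    have wD' : disk R _ w by apply/disk_enorm/ltW/open_disk_enorm.
    exists j => //; exists (Q p, exist (fun v => v \in D j) w (mem_set wD')) => //.
    by split=> //=; rewrite !set_valE /= wE.
  move=> [[p0 Zp]|[j Jj [[[v t] w] [/= vS vw Zw]] vtE]].
    by rewrite /G p0 cell_retract_fixed ?cell_push_bottom.
  by rewrite /G -vtE /= vw.
by apply: closed_preimage => //; exact: closedU.
Qed.

Lemma cell_retract_continuous : continuous cell_retract.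
Proof.
apply: (test_maps_prod_continuous (g := fun c (v : D c) => Phi (set_val v))).
- exact: unit_interval_compact.
- exact: unit_interval_hausdorff.
- move=> W oW; rewrite -closedC; apply: (cw_weak_topology (c0 := S)) => c.
  have -> : ~` W `&` @closed_cell _ _ S c =
      (fun v : D c => Phi (set_val v)) @` ((fun v : D c => Phi (set_val v)) @^-1` (~` W)).
    apply/seteqP; split=> x /=.
      move=> [Wx [v vD vx]]; exists (exist (fun v => v \in D c) v (mem_set vD)) => //=.
      by rewrite set_valE /= vx.
    by move=> [v Wv <-]; split=> //; exists (set_val v) => //; exact/set_mem/valP.
  apply: closed_image_compact.
  + exact: disk_subtype_compact.
  + exact: (cw_hausdorff S).
  + exact: char_map_set_continuous.
  + by rewrite preimage_setC closedC.
- move=> x; have [xD xE] := coordP x; exists (projT1 (coord x)).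
  have xD' : D _ (projT2 (coord x)) by apply/disk_enorm/ltW/open_disk_enorm.
  by exists (exist (fun v => v \in D _) _ (mem_set xD')).
- exact: cell_retract_char_map_continuous.
Qed.

Lemma pointed_cw_well_pointed : well_pointed R X.
Proof.
exists (fun p => (cell_retract p).1), (fun x => (cell_retract (x, ui1 R)).2).
split.
- exact: (continuous_compT (@continuous_fst _ _) cell_retract_continuous).
- apply: (continuous_compT (@continuous_snd _ _)).
  apply: (continuous_compT cell_retract_continuous).
  by apply: continuous_pair; [exact: continuous_id|exact: continuous_cst].
- by move=> x; rewrite cell_retract_fixed ?cell_push_bottom.
- by move=> t; rewrite cell_retract_fixed ?cell_push_point.
- split; first by rewrite cell_retract_fixed ?cell_push_point.
  by move=> x; exact: cell_retract_image.
Qed.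

End CWPointed.

(** * Homotopies *)

Section Homotopy.
Variable R : realType.
Local Notation I := (unit_interval R).

Lemma homotopic_sym (A B : topologicalType) (f g : A -> B) :
  homotopic R f g -> homotopic R g f.
Proof.
move=> [H [cH H0 H1]]; exists (fun p => H (p.1, clamp (1 - set_val p.2))); split.
- apply: (continuous_compT cH); apply: continuous_pair; first exact: continuous_fst.
  apply: continuous_clamp; apply: continuous_sub; first exact: continuous_cst.
  exact: (continuous_compT (@continuous_set_val _ I) (@continuous_snd _ _)).
- by move=> a; rewrite /= set_valE /= subr0 clamp1.
- by move=> a; rewrite /= set_valE /= subrr clamp0.
Qed.

Lemma homotopic_trans (A B : topologicalType) (f g h : A -> B) :
  homotopic R f g -> homotopic R g h -> homotopic R f h.
Proof.
move=> [F [cF F0 F1]] [G [cG G0 G1]].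
pose F' (p : A * I) := F (p.1, clamp (set_val p.2 * 2)).
pose G' (p : A * I) := G (p.1, clamp (set_val p.2 * 2 - 1)).
pose H (p : A * I) := if set_val p.2 <= 2^-1 then F' p else G' p.
have c2 : continuous (fun p : A * I => set_val p.2 * 2).
  apply: continuous_mul; last exact: continuous_cst.
  exact: (continuous_compT (@continuous_set_val _ I) (@continuous_snd _ _)).
have cs : continuous (fun p : A * I => set_val p.2).
  exact: (continuous_compT (@continuous_set_val _ I) (@continuous_snd _ _)).
exists H; split.
- apply: (@continuous_if_closed _ _ [set p : A * I | set_val p.2 <= 2^-1]
    [set p : A * I | 2^-1 <= set_val p.2] F' G').
  + exact: (closed_preimage cs (@closed_le _ _)).
  + exact: (closed_preimage cs (@closed_ge _ _)).
  + apply/seteqP; split=> // p _ /=.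
    by have [?|/ltW ?] := leP (set_val p.2) 2^-1; [left|right].
  + apply: (continuous_compT cF); apply: continuous_pair.
      exact: continuous_fst.
    exact: continuous_clamp.
  + apply: (continuous_compT cG); apply: continuous_pair.
      exact: continuous_fst.
    by apply: continuous_clamp; apply: continuous_sub => //; exact: continuous_cst.
  + by move=> p; rewrite /H /= => ->.
  + move=> p; rewrite /H /= => p2; case: ifP => // p2'.
    have E : set_val p.2 = 2^-1 by apply/eqP; rewrite eq_le p2 p2'.
    by rewrite /F' /G' E mulVf ?pnatr_eq0// subrr clamp0 clamp1 F1 G0.
- by move=> a; rewrite /H /F' set_valE /= invr_ge0 ler0n mul0r clamp0.
- move=> a; rewrite /H /G' set_valE /= ifF.
    by rewrite mul1r (_ : 2 - 1 = 1) ?clamp1//; lra.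
  by apply/negbTE; rewrite -ltNge; lra.
Qed.

Lemma has_right_homotopy_inverse_comp (A B C : topologicalType)
    (f : B -> C) (g : A -> B) : continuous f ->
  has_right_homotopy_inverse R f -> has_right_homotopy_inverse R g ->
  has_right_homotopy_inverse R (f \o g).
Proof.
move=> cf [s cs fs] [r cr [H [cH H0 H1]]]; exists (r \o s).
  exact: (continuous_compT cr cs).
apply: homotopic_trans fs; exists (fun p => f (H (s p.1, p.2))); split.
- apply: (continuous_compT cf); apply: (continuous_compT cH).
  apply: continuous_pair; last exact: continuous_snd.
  exact: (continuous_compT cs (@continuous_fst _ _)).
- by move=> a /=; rewrite H0.
- by move=> a /=; rewrite H1.
Qed.

(** A right homotopy inverse may be sought for the restriction of [f] along any
    map; for [f] the inclusion of polyhedral products this replaces [K] by a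
    smaller complex. *)
Lemma has_right_homotopy_inverse_factor (A B C : topologicalType)
    (f : B -> C) (g : A -> B) : continuous g ->
  has_right_homotopy_inverse R (f \o g) -> has_right_homotopy_inverse R f.
Proof.
by move=> cg [s cs fs]; exists (g \o s) => //; exact: (continuous_compT cg cs).
Qed.

End Homotopy.

(** * Reduced cones *)

Section ConeMaps.
Variables (R : realType) (Y : ptopologicalType).
Local Notation I := (unit_interval R).
Local Notation CY := (cone R Y).
Local Notation pi := (@cone_pi R Y).

Lemma cone_piK (c : CY) : pi (repr c) = c.
Proof. exact: reprK. Qed.

Lemma cone_pi_collapsed z w :
  cone_collapsed z -> cone_collapsed w -> pi z = pi w.
Proof.
move=> cz cw; apply/eqmodP; rewrite /= /cone_rel0 cz cw /=.
by rewrite orbT.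
Qed.

Lemma cone_pi_inj z w : pi z = pi w ->
  z = w \/ cone_collapsed z /\ cone_collapsed w.
Proof.
move/eqmodP; rewrite /= /cone_rel0 => /orP[/eqP|/andP[]]; first by left.
by right.
Qed.

Lemma cone_pi_continuous : continuous pi.
Proof. exact: pi_continuous. Qed.

Lemma cone_homotopy_continuous (Z : topologicalType) (F : CY * I -> Z) :
  continuous (fun p : (Y * I) * I => F (pi p.1, p.2)) -> continuous F.
Proof.
move=> cF; apply: (test_maps_prod_continuous (g := fun _ : unit => pi)) => //.
- exact: unit_interval_compact.
- exact: unit_interval_hausdorff.
- by move=> W /(_ tt).
- by move=> x; exists tt, (repr x); exact: cone_piK.
Qed.

Lemma cone_homotopy_descend (Z : topologicalType) (G : (Y * I) * I -> Z) :
  continuous G ->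
  (forall z w s, cone_collapsed z -> cone_collapsed w -> G (z, s) = G (w, s)) ->
  exists2 F : CY * I -> Z, continuous F & forall z s, F (pi z, s) = G (z, s).
Proof.
move=> cG Gc; pose F (p : CY * I) := G (repr p.1, p.2).
have FE z s : F (pi z, s) = G (z, s).
  rewrite /F /=; have := cone_piK (pi z).
  by move=> /cone_pi_inj[->//|[cz cw]]; exact: Gc.
exists F => //; apply: cone_homotopy_continuous.
by under eq_fun do rewrite FE -surjective_pairing.
Qed.

Lemma cone_base_collapsed z : cone_collapsed z -> range (@cone_base R Y) (pi z).
Proof.
move=> cz; exists point => //; apply: cone_pi_collapsed => //.
by rewrite /cone_collapsed /= eqxx orbT.
Qed.

Lemma cone_collapsed0 (y : Y) : cone_collapsed (y, ui0 R).
Proof. by rewrite /cone_collapsed /= eqxx. Qed.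

Lemma cone_collapsed_point t : cone_collapsed (point : Y, t : I).
Proof. by rewrite /cone_collapsed /= eqxx orbT. Qed.

Lemma cone_collapsedP (z : Y * I) : cone_collapsed z ->
  z.2 = ui0 R \/ z.1 = point.
Proof. by case/orP => /eqP; [left|right]. Qed.

Lemma cone_scaling : exists scale : CY * I -> CY,
  [/\ continuous scale, forall c, scale (c, ui1 R) = c
    & forall c, range (@cone_base R Y) (scale (c, ui0 R))].
Proof.
pose G (p : (Y * I) * I) : CY :=
  pi (p.1.1, clamp (set_val p.1.2 * set_val p.2)).
have c1 : continuous (fun p : (Y * I) * I => p.1.1).
  exact: (continuous_compT (@continuous_fst _ _) (@continuous_fst _ _)).
have c12 : continuous (fun p : (Y * I) * I => p.1.2).
  exact: (continuous_compT (@continuous_snd _ _) (@continuous_fst _ _)).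
have c2 : continuous (fun p : (Y * I) * I => set_val p.1.2).
  exact: (continuous_compT (@continuous_set_val _ I) c12).
have c3 : continuous (fun p : (Y * I) * I => set_val p.2).
  exact: (continuous_compT (@continuous_set_val _ I) (@continuous_snd _ _)).
have cG : continuous G.
  apply: (continuous_compT cone_pi_continuous); apply: continuous_pair => //.
  by apply: continuous_clamp; exact: continuous_mul.
have collapsedG (z : Y * I) (s : I) : cone_collapsed z ->
    cone_collapsed (z.1, clamp (set_val z.2 * set_val s)).
  move=> cz; have [->|->] := cone_collapsedP cz; last exact: cone_collapsed_point.
  by rewrite set_val_ui0 mul0r clamp0 cone_collapsed0.
have [z w s cz cw|scale cscale scaleE] := cone_homotopy_descend cG.
  by apply: cone_pi_collapsed; exact: collapsedG.
exists scale; split=> // c; rewrite -(cone_piK c) scaleE /G /=.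
  by rewrite set_val_ui1 mulr1 clamp_val -surjective_pairing.
rewrite set_val_ui0 mulr0 clamp0; apply: cone_base_collapsed.
exact: cone_collapsed0.
Qed.

(** The homotopy used on the coordinate of a vertex that is to be isolated. It
    moves points of the base within the base; while it does so to the other
    points, [lam] tells how far the neighbouring coordinates must be contracted:
    not at all over the base, and completely before the coordinate may rest off
    the base at time [1].

    With [phi] stretching the middle third of [0, 1] to the whole of it and [b]
    a bump equal to [1] on that third and [0] at both ends, the two maps end with
    [(h (y, 1), phi t)] and [1 - (1 - w y) * b t]. In the middle third the latter
    is [0], unless [w y] is positive and then [h (y, 1)] is the base point.
    The factor [1 - w y] makes [lam] constant on the collapsed part of the
    cylinder, as the reduced cone demands. *)
Lemma cone_deformation : well_pointed R Y ->
  exists (psi : CY * I -> CY) (lam : CY * I -> I),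
  [/\ continuous psi /\ continuous lam,
      forall c, psi (c, ui0 R) = c /\ lam (c, ui0 R) = ui1 R,
      forall c s, range (@cone_base R Y) c ->
        range (@cone_base R Y) (psi (c, s)) /\ lam (c, s) = ui1 R
    & forall c, lam (c, ui1 R) = ui0 R \/
        range (@cone_base R Y) (psi (c, ui1 R))].
Proof.
move=> [h [w [ch cw h0 hpt [wpt wh]]]].
pose phi (x : R) : R := set_val (clamp (3 * x - 1)).
pose b (x : R) : R := set_val (clamp (3 * Num.min x (1 - x))).
have cy : continuous (fun p : (Y * I) * I => p.1.1).
  exact: (continuous_compT (@continuous_fst _ _) (@continuous_fst _ _)).
have c12 : continuous (fun p : (Y * I) * I => p.1.2).
  exact: (continuous_compT (@continuous_snd _ _) (@continuous_fst _ _)).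
have ct : continuous (fun p : (Y * I) * I => set_val p.1.2).
  exact: (continuous_compT (@continuous_set_val _ I) c12).
have cs : continuous (fun p : (Y * I) * I => set_val p.2).
  exact: (continuous_compT (@continuous_set_val _ I) (@continuous_snd _ _)).
have ccst (a : R) : continuous (fun _ : (Y * I) * I => a) by exact: continuous_cst.
have cphi : continuous (fun p : (Y * I) * I => phi (set_val p.1.2)).
  apply: (continuous_compT (@continuous_set_val _ I)); apply: continuous_clamp.
  by apply: continuous_sub => //; exact: continuous_mul.
have cb : continuous (fun p : (Y * I) * I => b (set_val p.1.2)).
  apply: (continuous_compT (@continuous_set_val _ I)); apply: continuous_clamp.
  apply: continuous_mul => //; apply: continuous_minr => //.
  exact: continuous_sub.
pose P (p : (Y * I) * I) : Y * I := (h (p.1.1, p.2),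
  clamp ((1 - set_val p.2) * set_val p.1.2 + set_val p.2 * phi (set_val p.1.2))).
pose L (p : (Y * I) * I) : I :=
  clamp (1 - set_val p.2 * (1 - set_val (w p.1.1)) * b (set_val p.1.2)).
have phi0 : phi 0 = 0 by rewrite /phi clamp_le0 ?set_val_ui0 ?set_val_ui1//; lra.
have phi1 : phi 1 = 1 by rewrite /phi clamp_ge1 ?set_val_ui0 ?set_val_ui1//; lra.
have b0 : b 0 = 0 by rewrite /b clamp_le0 ?set_val_ui0 ?set_val_ui1// ?subr0 min_l//; lra.
have b1 : b 1 = 0 by rewrite /b clamp_le0 ?set_val_ui0 ?set_val_ui1// ?subrr min_r//; lra.
have collapsedP (z : Y * I) (s : I) : cone_collapsed z -> cone_collapsed (P (z, s)).
  rewrite /P /= => cz; have [->|->] := cone_collapsedP cz.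
    by rewrite set_val_ui0 phi0 !mulr0 addr0 clamp0 cone_collapsed0.
  by rewrite hpt cone_collapsed_point.
have collapsedL (z : Y * I) (s : I) : cone_collapsed z -> L (z, s) = ui1 R.
  rewrite /L /= => cz; have [->|->] := cone_collapsedP cz.
    by rewrite set_val_ui0 b0 mulr0 subr0 clamp1.
  by rewrite wpt set_val_ui1 subrr mulr0 mul0r subr0 clamp1.
have cP : continuous (pi \o P).
  apply: (continuous_compT cone_pi_continuous); apply: continuous_pair.
    apply: (continuous_compT ch); apply: continuous_pair => //.
    exact: continuous_snd.
  apply: continuous_clamp; apply: continuous_add; apply: continuous_mul => //.
  exact: continuous_sub.
have cL : continuous L.
  apply: continuous_clamp; apply: continuous_sub => //.
  apply: continuous_mul => //; apply: continuous_mul => //.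
  apply: continuous_sub => //; apply: (continuous_compT (@continuous_set_val _ I)).
  exact: (continuous_compT cw cy).
have [|psi cpsi psiE] := cone_homotopy_descend cP.
  by move=> z z' s cz cz'; apply: cone_pi_collapsed; exact: collapsedP.
have [|lam clam lamE] := cone_homotopy_descend cL.
  by move=> z z' s cz cz'; rewrite !collapsedL.
exists psi, lam; split=> //.
- move=> c; rewrite -(cone_piK c) psiE lamE /P /L /=; case: (repr c) => y t /=.
  rewrite h0 set_val_ui0 subr0 mul1r !mul0r addr0 subr0.
  by rewrite clamp_val clamp1.
- move=> c s [y _ <-]; rewrite /cone_base psiE lamE /P /L /=.
  rewrite !set_val_ui1 phi1 b1 mulr0 subr0 clamp1 !mulr1 subrK clamp1.
  by split=> //; exists (h (y, s)).
move=> c; rewrite -(cone_piK c); case: (repr c) => y t; rewrite psiE lamE /P /L /=.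
rewrite !set_val_ui1 subrr mul0r add0r !mul1r.
have [t3|t3] := leP (set_val t) 3^-1.
  right; apply: cone_base_collapsed.
  rewrite /phi (@clamp_le0 _ (_ - 1)); last by lra.
  by rewrite set_val_ui0 clamp0 cone_collapsed0.
have [t6|t6] := leP (2 / 3) (set_val t).
  right; exists (h (y, ui1 R)) => //.
  rewrite /phi (@clamp_ge1 _ (_ - 1)); last by lra.
  by rewrite set_val_ui1 clamp1.
have [wy|hy] := wh y; last first.
  by right; apply: cone_base_collapsed; rewrite hy cone_collapsed_point.
left; rewrite wy set_val_ui0 /b (@clamp_ge1 _ (3 * _)).
  by rewrite set_val_ui1 subr0 mulr1 subrr clamp0.
have : 3^-1 <= Num.min (set_val t) (1 - set_val t) by rewrite le_min; lra.
lra.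
Qed.

End ConeMaps.

(** * Polyhedral products *)

Definition down_closed m (K : {set {set 'I_m}}) :=
  forall s t : {set 'I_m}, s \in K -> t \subset s -> t \in K.

Lemma dependent_function_choice (J : Type) (T : J -> Type)
    (P : forall j, T j -> Prop) :
  (forall j, exists y, P j y) -> exists f : forall j, T j, forall j, P j (f j).
Proof.
by move=> H; exists (fun j => projT1 (cid (H j))) => j; exact: projT2 (cid (H j)).
Qed.

Section PolyhedralProducts.
Variables (R : realType) (m : nat) (Y : 'I_m -> ptopologicalType).
Local Notation I := (unit_interval R).
Local Notation CY := (cone_product R Y).
Local Notation PP := (@polyhedral_product R m Y).
Local Notation base i := (range (@cone_base R (Y i))).
Implicit Types (K L M : {set {set 'I_m}}) (x : CY).

(** A point lies in the polyhedral product of a complex exactly when these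
    coordinates form a face ([polyhedral_productE]), so maps of polyhedral
    products are controlled by following this set. *)
Definition off_base x : {set 'I_m} := [set i | ~~ `[< base i (x i) >]]%SET.

Lemma off_baseP x i : reflect (~ base i (x i)) (i \in off_base x).
Proof. by rewrite inE; apply: (iffP negP) => H /asboolP. Qed.

Lemma polyhedral_productE K x : down_closed K ->
  PP K x <-> off_base x \in K.
Proof.
move=> dK; split=> [[s /= sK xs]|xK].
  apply: dK sK _; apply/fintype.subsetP => i /off_baseP ix.
  by apply/negPn/negP => /xs.
by exists (off_base x) => // i /off_baseP/contrapT.
Qed.

Lemma pp_incl_continuous K L (KL : K \subset L) :
  continuous (@pp_incl R m Y K L KL).
Proof. by apply: continuous_to_set; exact: continuous_set_val. Qed.

Lemma pp_incl_comp K L M (KL : K \subset L) (LM : L \subset M)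
    (KM : K \subset M) :
  @pp_incl R m Y K M KM = pp_incl LM \o pp_incl KL.
Proof. by apply/funext => x; exact: val_inj. Qed.

Lemma pp_incl_right_inverse_of_deformation K L (LK : L \subset K)
    (H : CY * I -> CY) : continuous H -> (forall x, H (x, ui0 R) = x) ->
  (forall x t, PP K x -> PP K (H (x, t))) ->
  (forall x, PP K x -> PP L (H (x, ui1 R))) ->
  has_right_homotopy_inverse R (@pp_incl R m Y L K LK).
Proof.
move=> cH H0 HK HL.
pose s (x : PP K) : PP L := exist (fun x => x \in PP L) (H (set_val x, ui1 R))
  (mem_set (HL _ (set_mem (valP x)))).
pose F (p : PP K * I) : PP K := exist (fun x => x \in PP K)
  (H (set_val p.1, p.2)) (mem_set (HK _ p.2 (set_mem (valP p.1)))).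
exists s.
  apply: continuous_to_set; apply: (continuous_compT cH).
  by apply: continuous_pair; [exact: continuous_set_val|exact: continuous_cst].
apply: homotopic_sym; exists F; split.
- apply: continuous_to_set; apply: (continuous_compT cH).
  apply: continuous_pair; last exact: continuous_snd.
  exact: (continuous_compT (@continuous_set_val _ _) (@continuous_fst _ _)).
- by move=> a; apply: val_inj; rewrite /= H0.
- by move=> a; apply: val_inj.
Qed.

(** Isolating a vertex [v] whose closed star is the simplex on [v |: N]. Deform
    the coordinate of [v] by [psi] and, at the same time, contract those of [N]
    by the factor [lam]. Where the coordinate of [v] starts in the base, no
    coordinate leaves the base; where it does not, the coordinates off the base
    stay inside the face [v |: N]. At the end either the coordinate of [v] is in
    the base, or those of [N] are at the cone points, which belong to the base,
    and [v] is alone. *)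
Lemma pp_incl_isolate_simplicial_vertex K L (LK : L \subset K)
    (v : 'I_m) (N : {set 'I_m}) :
  (forall i, well_pointed R (Y i)) ->
  down_closed K -> down_closed L -> v \notin N -> (v |: N)%SET \in K ->
  (forall s, s \in K -> v \in s -> s \subset (v |: N)%SET) ->
  [set v]%SET \in L -> (forall s, s \in K -> v \notin s -> s \in L) ->
  has_right_homotopy_inverse R (@pp_incl R m Y L K LK).
Proof.
move=> wY dK dL vN vNK KN vL KL.
have [psi psiE] := dependent_function_choice (fun i => cone_deformation (wY i)).
have [lam psiP] := dependent_function_choice psiE.
have [scale scaleP] := dependent_function_choice (fun i => cone_scaling R (Y i)).
pose H (p : CY * I) : CY := fun i =>
  if i == v then psi i (p.1 i, p.2)
  else if i \in N then scale i (p.1 i, lam v (p.1 v, p.2)) else p.1 i.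
have proj i : continuous (fun p : CY * I => p.1 i).
  have ci : continuous (fun x : CY => x i).
    exact: (@proj_continuous _ (fun j => cone R (Y j)) i).
  exact: (continuous_compT ci (@continuous_fst _ _)).
have cH : continuous H.
  apply: continuous_prod_topology => i; rewrite /H.
  case: (i == v).
    have [[cpsi _] _ _ _] := psiP i; apply: (continuous_compT cpsi).
    by apply: continuous_pair; [exact: proj|exact: continuous_snd].
  case: (i \in N); last exact: proj.
  have [cscale _ _] := scaleP i; apply: (continuous_compT cscale).
  apply: continuous_pair; first exact: proj.
  have [[_ clam] _ _ _] := psiP v; apply: (continuous_compT clam).
  by apply: continuous_pair; [exact: proj|exact: continuous_snd].
(* The coordinates of [N] move only while [lam] differs from [1]. *)
have Hlam1 x t i : i != v -> lam v (x v, t) = ui1 R -> H (x, t) i = x i.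
  move=> iv l1; rewrite /H /= (negbTE iv) l1; case: ifP => // _.
  by have [_ -> _] := scaleP i.
have Hbase x t : v \notin off_base x -> off_base (H (x, t)) \subset off_base x.
  move=> /off_baseP/contrapT bv; have [_ _ /(_ _ t bv) [bpsi l1] _] := psiP v.
  apply/fintype.subsetP => i; have [->|iv] := eqVneq i v.
    by move=> /off_baseP; rewrite /H eqxx.
  by move=> /off_baseP; rewrite Hlam1// => /off_baseP.
have Hoff x t : off_base x \in K -> v \in off_base x ->
    off_base (H (x, t)) \subset (v |: N)%SET.
  move=> xK xv; apply/fintype.subsetP => i /off_baseP Hi; rewrite !inE.
  have [//|iv /=] := eqVneq i v; apply/negPn/negP => iN.
  move: Hi; rewrite /H (negbTE iv) (negbTE iN) /= => /off_baseP ix.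
  have := fintype.subsetP (KN _ xK xv) i ix.
  by rewrite !inE (negbTE iv) (negbTE iN).
apply: (@pp_incl_right_inverse_of_deformation _ _ LK H) => //.
- move=> x; apply/functional_extensionality_dep => i.
  have [_ /(_ (x v)) [_ l1] _ _] := psiP v.
  have [->|iv] := eqVneq i v; last by rewrite Hlam1.
  by rewrite /H eqxx /=; have [_ /(_ (x v)) [-> _] _ _] := psiP v.
- move=> x t /(polyhedral_productE _ dK) xK; apply/(polyhedral_productE _ dK).
  have [xv|xv] := boolP (v \in off_base x); last exact: dK xK (Hbase _ _ xv).
  exact: dK vNK (Hoff _ _ xK xv).
move=> x /(polyhedral_productE _ dK) xK; apply/(polyhedral_productE _ dL).
have [xv|xv] := boolP (v \in off_base x); last first.
  exact: dL (KL _ xK xv) (Hbase _ _ xv).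
have HN := Hoff _ (ui1 R) xK xv.
have [_ _ _ /(_ (x v)) [l0|bv]] := psiP v; last first.
  have vH : v \notin off_base (H (x, ui1 R)).
    by apply/off_baseP; rewrite /H eqxx; exact.
  by apply: KL => //; exact: dK vNK HN.
apply: dL vL _; apply/fintype.subsetP => i iH.
have := fintype.subsetP HN i iH; rewrite !inE => /orP[//|iN].
have iv : i != v by apply: contraNneq vN => <-.
move/off_baseP: iH; rewrite /H (negbTE iv) iN l0 /=.
by have [_ _ /(_ (x i))] := scaleP i.
Qed.

End PolyhedralProducts.

(** * Chordal graphs *)

Section CyclicSequences.
Local Open Scope nat_scope.
Variable T : eqType.
Implicit Types (x y z : T) (p s : seq T).

Lemma index_uniq_cat p x s : uniq (p ++ x :: s) -> index x (p ++ x :: s) = size p.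
Proof.
rewrite cat_uniq /= negb_or => /and3P[_ /andP[xp _] _].
by rewrite index_cat (negbTE xp) /= eqxx addn0.
Qed.

Lemma next_consecutive x p1 y z p2 : uniq (x :: p1 ++ y :: z :: p2) ->
  next (x :: p1 ++ y :: z :: p2) y = z.
Proof.
move=> U; rewrite next_nth -cat_cons mem_cat mem_head orbT.
rewrite index_uniq_cat //= -[size p1]addn0 -[(_ + 0).+1]addnS.
by rewrite nth_cat ltnNge leq_addr /= addKn.
Qed.

Lemma next_last x p y : uniq (x :: rcons p y) -> next (x :: rcons p y) y = x.
Proof.
move=> U; rewrite next_nth inE mem_rcons mem_head orbT -cats1 -cat_cons.
rewrite index_uniq_cat //=; last by rewrite cats1.
by rewrite nth_default // size_cat addn1.
Qed.

End CyclicSequences.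

Section ChordalGraphs.
Local Open Scope nat_scope.
Variables (m : nat) (e : rel 'I_m).
Hypotheses (e_sym : symmetric e) (e_irr : irreflexive e) (e_chordal : chordal e).
Implicit Types (x y z v a b c : 'I_m) (s p : seq 'I_m) (S T U : {set 'I_m}).

(** If [x] is adjacent to [a] and [b] but to no vertex of [T], then [x] followed
    by a path from [a] to [b] through [T] is a cycle whose chords all join two
    vertices of the path, and a chord shortcuts the path. The path is taken with
    [x] in front, which is possible as [x] is adjacent to [a] and spares a
    separate treatment of its first vertex. *)
Lemma shortcut_of_chordal x a b T s :
  e x a -> e x b -> a != b -> ~~ e a b ->
  (forall z, z \in T -> z != x /\ ~~ e x z) ->
  head x s = a -> last x s = b -> path e x s -> uniq s ->
  (forall z, z \in s -> [|| z \in T, z == a | z == b]) ->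
  exists2 s', size s' < size s & [/\ head x s' = a, last x s' = b, path e x s',
    uniq s' & forall z, z \in s' -> [|| z \in T, z == a | z == b]].
Proof.
move=> xa xb ab nab xT hs ls ps us sT.
have xs : x \notin s.
  apply/negP => /sT /or3P[/xT[]|/eqP xa'|/eqP xb']; first by rewrite eqxx.
    by rewrite -xa' e_irr in xa.
  by rewrite -xb' e_irr in xb.
have uxs : uniq (x :: s) by rewrite /= xs.
have cxs : ucycle e (x :: s).
  by rewrite /ucycle uxs andbT /= rcons_path ps ls e_sym xb.
have s4 : 3 < size (x :: s).
  case: s hs ls ps {us sT xs uxs cxs} => [|a' [|b' [|? ?]]] //=.
  - by move=> E; move: xa; rewrite -E e_irr.
  - by move=> -> E; rewrite E eqxx in ab.
  - by move=> -> -> /and3P[_]; rewrite (negbTE nab).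
have nx : next (x :: s) x = a by rewrite next_nth mem_head /= eqxx nth0.
have nb : next (x :: s) b = x.
  case/lastP: s ls uxs {hs ps us sT xs cxs s4 nx} => [/= xb'|s b'].
    by rewrite -xb' e_irr in xb.
  by rewrite last_rcons => ->; exact: next_last.
(* The chord from [u] to [w] replaces the nonempty part [p2] of the path. *)
have cut u w p1 p2 p3 : s = p1 ++ u :: p2 ++ w :: p3 -> e u w ->
    w != next (x :: s) u ->
  exists2 s', size s' < size s & [/\ head x s' = a, last x s' = b, path e x s',
    uniq s' & forall z, z \in s' -> [|| z \in T, z == a | z == b]].
  move=> sE uw nuw; exists (p1 ++ u :: w :: p3).
    case: p2 sE nuw => [|z p2] sE nuw; last first.
      by rewrite sE !size_cat ltn_add2l /= size_cat /= !ltnS leq_addl.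
    rewrite cat0s in sE; move: nuw; rewrite sE next_consecutive ?eqxx//.
    by rewrite -sE.
  have sub : subseq (p1 ++ u :: w :: p3) s.
    rewrite sE; apply: cat_subseq; first exact: subseq_refl.
    by rewrite /= eqxx; exact: suffix_subseq.
  split.
  - by rewrite -hs sE; case: (p1).
  - by rewrite -ls sE !last_cat /= last_cat.
  - move: ps; rewrite sE !cat_path /= cat_path /=.
    by move=> /and3P[-> -> /and3P[_ _ ->]]; rewrite uw.
  - exact: subseq_uniq sub us.
  - by move=> z /(mem_subseq sub); exact: sT.
have xnbr z : z \in s -> e x z -> z = a \/ z = b.
  move=> /sT /or3P[/xT[_ /negbTE ->]//|/eqP|/eqP]; by [left|right].
have [u [w [uc wc uw wnu unw]]] := e_chordal cxs s4.
move: uc wc; rewrite !inE => /predU1P[ux|us'] /predU1P[wx|ws'].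
- by rewrite ux wx e_irr in uw.
- rewrite ux in uw wnu unw; have [wa|wb] := xnbr _ ws' uw.
    by rewrite nx wa eqxx in wnu.
  by rewrite wb nb eqxx in unw.
- rewrite wx e_sym in uw; rewrite wx in wnu unw; have [ua|ub] := xnbr _ us' uw.
    by rewrite nx ua eqxx in unw.
  by rewrite ub nb eqxx in wnu.
have [p1 [r sE]] : exists p1 r, s = p1 ++ u :: r.
  by move: us'; case/splitPr => p1 r; exists p1, r.
move: ws'; rewrite sE mem_cat inE => /or3P[wp|/eqP wu|wr].
- have [p0 [p2 pE]] : exists p0 p2, p1 = p0 ++ w :: p2.
    by move: wp; case/splitPr => p0 p2; exists p0, p2.
  rewrite -sE; apply: (cut w u p0 p2 r) => //; last by rewrite e_sym.
  by rewrite sE pE -catA.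
- by rewrite wu e_irr in uw.
have [p2 [p3 rE]] : exists p2 p3, r = p2 ++ w :: p3.
  by move: wr; case/splitPr => p2 p3; exists p2, p3.
by rewrite -sE; apply: (cut u w p1 p2 p3) => //; rewrite sE rE.
Qed.

(** Were [a] and [b] not adjacent, the paths through [T] could be shortened for
    ever. *)
Lemma chordal_separator_clique x a b T s :
  e x a -> e x b -> a != b -> (forall z, z \in T -> z != x /\ ~~ e x z) ->
  path e a (rcons s b) -> {subset s <= T} -> e a b.
Proof.
move=> xa xb ab xT ps sT; apply/negPn/negP => nab.
have [p [pp up pT lp]] : exists p, [/\ path e a p, uniq (a :: p),
    {subset p <= rcons s b} & last a p = b].
  by move: (last_rcons a s b); case/shortenP: ps => p pp up sub lp; exists p.
pose good s' := [/\ head x s' = a, last x s' = b, path e x s',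
    uniq s' & forall z, z \in s' -> [|| z \in T, z == a | z == b]].
have g0 : good (a :: p).
  split=> //=; first by apply/andP.
  move=> z; rewrite inE => /predU1P[->|/pT]; first by rewrite eqxx orbT.
  by rewrite mem_rcons inE => /predU1P[->|/sT ->//]; rewrite eqxx !orbT.
move: {2}(size (a :: p)).+1 (ltnSn (size (a :: p))) => n.
elim: n (a :: p) g0 => // n IH r [hr lr pr ur rT]; rewrite ltnS => rn.
have [r' r'r g'] := shortcut_of_chordal xa xb ab nab xT hr lr pr ur rT.
exact: IH _ g' (leq_trans r'r rn).
Qed.

Definition simplicial_in S v :=
  forall a b, a \in S -> b \in S -> e v a -> e v b -> a != b -> e a b.

(** The form of Dirac's theorem that goes through by induction. Let [C] be a
    connected component of the non-neighbours [T] of [x], and [B] its boundary,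
    which consists of neighbours of [x]. By [chordal_separator_clique], [B] is a
    clique; and all neighbours of a vertex of [C] lie in [U], the union of [C]
    and [B], so it suffices to find a vertex of [C] that is simplicial in [U].
    If [U] is not a clique, the induction hypothesis gives a simplicial [v] of
    [U]; if [v] is in [B], then the vertex [c] it avoids is in [C], and the
    hypothesis applied to [v] and [c] gives a vertex not adjacent to [v], which
    cannot be in the clique [B] again. *)
Lemma chordal_simplicial_non_neighbour S x y : x \in S -> y \in S -> y != x ->
  ~~ e x y -> exists2 v, v \in S & [/\ v != x, ~~ e x v & simplicial_in S v].
Proof.
move: {2}#|S|.+1 (ltnSn #|S|) => n; elim: n S x y => // n IH S x y.
rewrite ltnS => Sn xS yS yx xy.
pose T := [set z in S | (z != x) && ~~ e x z]%SET.
have TP z : z \in T -> z != x /\ ~~ e x z by rewrite inE => /and3P[].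
pose r : rel 'I_m := [rel u w | [&& e u w, u \in T & w \in T]].
have r_sym : connect_sym r.
  by apply: sym_connect_sym => u w; rewrite /r /= e_sym [(w \in T) && _]andbC.
have yT : y \in T by rewrite inE yS yx.
pose C := [set z in T | connect r y z]%SET.
pose B := [set z in S | e x z && [exists c in C, e c z]]%SET.
pose U := (C :|: B)%SET.
have yC : y \in C by rewrite inE yT connect0.
have CT z : z \in C -> z \in T by rewrite inE => /andP[].
have TS z : z \in T -> z \in S by rewrite inE => /andP[].
have CU z c : c \in C -> z \in S -> e c z -> z \in U.
  move=> cC zS cz; rewrite finset.in_setU; have [_ xc] := TP _ (CT _ cC).
  have [xz|xz] := boolP (e x z).
    by apply/orP; right; rewrite inE zS xz; apply/existsP; exists c; rewrite cC.
  have zT : z \in T.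
    by rewrite inE zS xz andbT; apply: contraNneq xc => <-; rewrite e_sym.
  apply/orP; left; rewrite inE zT /=; move: (cC); rewrite inE => /andP[cT yc].
  by apply: connect_trans yc _; apply: connect1; rewrite /r /= cz cT.
have Bclique a b : a \in B -> b \in B -> a != b -> e a b.
  rewrite !inE => /and3P[_ xa /existsP[c /andP[cC ca]]].
  move=> /and3P[_ xb /existsP[d /andP[dC db]]] ab.
  have : connect r c d.
    move: cC dC; rewrite !inE => /andP[_ yc] /andP[_ yd].
    by apply: connect_trans yd; rewrite r_sym.
  move=> /connectP[p pp pd].
  have pT : {subset c :: p <= T}.
    move=> z; rewrite inE => /predU1P[->|]; first exact: CT.
    elim: p c pp {ca cC pd} => //= w p IHp c /andP[/and3P[_ _ wT] pw].
    by rewrite inE => /predU1P[->//|]; exact: IHp pw.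
  apply: (chordal_separator_clique xa xb ab TP (s := c :: p)) => //.
  rewrite rcons_cons /= e_sym ca rcons_path -pd db andbT.
  by apply: sub_path pp => u w /and3P[].
have simplC v : v \in C -> simplicial_in U v ->
    exists2 v, v \in S & [/\ v != x, ~~ e x v & simplicial_in S v].
  move=> vC vU; have [vx xv] := TP _ (CT _ vC); exists v; first exact/TS/CT.
  split=> // a b aS bS va vb; apply: vU => //; [exact: CU va|exact: CU vb].
have US : U \subset S.
  apply/fintype.subsetP => z; rewrite finset.in_setU => /orP[/CT/TS//|].
  by rewrite inE => /andP[].
have xU : x \notin U.
  rewrite finset.in_setU negb_or; apply/andP; split; last by rewrite inE e_irr andbF.
  by apply/negP => /CT/TP[]; rewrite eqxx.
have Un : #|U| < n.
  apply: leq_trans Sn; apply: proper_card; apply/properP; split=> //.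
  by exists x.
have [Uclique|] := boolP [forall a in U, forall b in U, (a != b) ==> e a b].
  apply: (simplC y yC) => a b aU bU _ _ ab.
  by move/forall_inP: Uclique => /(_ _ aU)/forall_inP/(_ _ bU)/implyP; exact.
rewrite negb_forall_in => /exists_inP[c cU]; rewrite negb_forall_in.
move=> /exists_inP[z zU]; rewrite negb_imply => /andP[cz ncz].
have [v vU [vc ncv vs]] : exists2 v, v \in U & [/\ v != c, ~~ e c v & simplicial_in U v].
  by apply: (IH U c z) => //; rewrite eq_sym.
have := vU; rewrite finset.in_setU => /orP[vC|vB]; first exact: simplC vC vs.
have cB : c \notin B by apply: contraNN ncv => cB; apply: Bclique => //; rewrite eq_sym.
have [w wU [wv nvw ws]] :
    exists2 w, w \in U & [/\ w != v, ~~ e v w & simplicial_in U w].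
  by apply: (IH U v c) => //; rewrite 1?eq_sym 1?e_sym.
have := wU; rewrite finset.in_setU => /orP[wC|wB]; first exact: simplC wC ws.
by case/negP: nvw; apply: Bclique => //; rewrite eq_sym.
Qed.

(** Dirac's theorem for the graph induced on [S]. Chordality is asked of the
    ambient graph, so that [S] can shrink vertex by vertex. *)
Lemma chordal_simplicial_vertex S x : x \in S ->
  exists2 v, v \in S & simplicial_in S v.
Proof.
move=> xS.
have [Sclique|] := boolP [forall a in S, forall b in S, (a != b) ==> e a b].
  exists x => // a b aS bS _ _ ab.
  by move/forall_inP: Sclique => /(_ _ aS)/forall_inP/(_ _ bS)/implyP; exact.
rewrite negb_forall_in => /exists_inP[c cS]; rewrite negb_forall_in.
move=> /exists_inP[z zS]; rewrite negb_imply eq_sym => /andP[cz ncz].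
by have [v vS [_ _ vs]] := chordal_simplicial_non_neighbour cS zS cz ncz; exists v.
Qed.

End ChordalGraphs.

(** * Flag complexes of chordal graphs *)

Section CliqueComplexes.
Variables (m : nat) (e : rel 'I_m).
Implicit Types (s t S : {set 'I_m}) (v : 'I_m).

Definition clique s : bool :=
  [forall x in s, forall y in s, (x != y) ==> e x y].

Lemma cliqueP s : reflect {in s &, forall x y, x != y -> e x y} (clique s).
Proof.
apply: (iffP forall_inP) => [H x y xs ys xy|H x xs].
  by move: (H x xs) => /forall_inP/(_ y ys)/implyP; exact.
by apply/forall_inP => y ys; apply/implyP; exact: H.
Qed.

(** The flag complex of the graph induced on [S], together with the vertices
    outside [S] as isolated points. It interpolates between the discrete complex
    ([S] empty) and the flag complex of the whole graph. *)
Definition clique_complex S : {set {set 'I_m}} :=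
  [set s | clique s && ((s \subset S) || (#|s| <= 1)%N)]%SET.

Lemma clique_complex_down_closed S : down_closed (clique_complex S).
Proof.
move=> s t; rewrite !inE => /andP[/cliqueP cs sS] ts; apply/andP; split.
  by apply/cliqueP => x y xt yt; apply: cs; exact: (fintype.subsetP ts).
case/orP: sS => sS; apply/orP; [left|right]; first exact: fintype.subset_trans sS.
exact: leq_trans (subset_leq_card ts) sS.
Qed.

Lemma clique_complexS S S' : S \subset S' ->
  clique_complex S \subset clique_complex S'.
Proof.
move=> SS'; apply/fintype.subsetP => s; rewrite !inE => /andP[-> /orP[sS|->]].
  by rewrite (fintype.subset_trans sS SS').
by rewrite orbT.
Qed.

Lemma set1_clique_complex v S : [set v]%SET \in clique_complex S.
Proof.
rewrite inE cards1 orbT andbT; apply/cliqueP => x y.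
by rewrite !inE => /eqP-> /eqP->; rewrite eqxx.
Qed.

(** A simplicial vertex of the graph induced on [S] can be isolated, which
    removes it from [S]. *)
Lemma clique_complex_right_inverse (R : realType) (Y : 'I_m -> ptopologicalType)
    S (H : clique_complex finset.set0 \subset clique_complex S) :
  (forall i, well_pointed R (Y i)) ->
  symmetric e -> irreflexive e -> chordal e ->
  has_right_homotopy_inverse R (pp_incl (R := R) (Y := Y) H).
Proof.
move=> wY e_sym e_irr e_ch; move: {2}#|S|.+1 (ltnSn #|S|) => n.
elim: n S H => // n IH S H; rewrite ltnS => Sn.
have [S0|[x xS]] := set_0Vmem S.
  apply: (@pp_incl_right_inverse_of_deformation _ _ _ _ _ H fst) => //.
    exact: continuous_fst.
  by move: H; rewrite S0.
have [v vS vsimpl] := chordal_simplicial_vertex e_sym e_irr e_ch xS.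
have SvS : (S :\ v)%SET \subset S by exact: subD1set.
have H1 := clique_complexS (finset.sub0set (S :\ v)%SET).
have H2 := clique_complexS SvS.
rewrite (pp_incl_comp R Y H1 H2 H); apply: has_right_homotopy_inverse_comp.
- exact: pp_incl_continuous.
- pose N := [set z in S | e v z]%SET.
  apply: (@pp_incl_isolate_simplicial_vertex _ _ _ _ _ H2 v N) => //.
  + exact: clique_complex_down_closed.
  + exact: clique_complex_down_closed.
  + by rewrite inE e_irr andbF.
  + rewrite inE; apply/andP; split; last first.
      apply/orP; left; apply/fintype.subsetP => z; rewrite !inE.
      by move=> /predU1P[->//|/andP[]].
    apply/cliqueP => a b; rewrite !inE.
    move=> /predU1P[->|/andP[aS va]] /predU1P[->|/andP[bS vb]] //.
    * by rewrite eqxx.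
    * by rewrite e_sym.
    * exact: vsimpl.
  + move=> s; rewrite inE => /andP[/cliqueP cs sS] vs.
    apply/fintype.subsetP => z zs; rewrite !inE; have [//|zv /=] := eqVneq z v.
    rewrite cs ?andbT 1?eq_sym //; case/orP: sS => [/fintype.subsetP|]; first exact.
    by move/card_le1_eqP => /(_ _ _ zs vs) E; rewrite E eqxx in zv.
  + exact: set1_clique_complex.
  + move=> s; rewrite !inE => /andP[-> sS] vs /=.
    by rewrite subsetD1 vs andbT.
- by apply: IH; apply: leq_trans Sn; rewrite (cardsD1 v S) vS.
Qed.

End CliqueComplexes.

Lemma flagification_clique_complex m (K : {set {set 'I_m}}) :
  simplicial_complex K ->
  flagification K = clique_complex (skel1 K) finset.setT.
Proof.
move=> cK; have [/andP[_ /forallP flagF] KF minF] := flagificationP cK.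
apply/eqP; rewrite finset.eqEsubset; apply/andP; split; last first.
  apply/fintype.subsetP => s; rewrite inE => /andP[/cliqueP cs _].
  move: (flagF s) => /implyP; apply; apply/forall_inP => x xs.
  apply/forall_inP => y ys; apply/implyP => xy; rewrite /skel1 xy /=.
  by apply: (fintype.subsetP KF); move: (cs x y xs ys xy) => /andP[].
case/and3P: cK => K0 /forallP K1 /forall_inP Kdown.
have Kd (s t : {set 'I_m}) : s \in K -> t \subset s -> t \in K.
  by move=> /Kdown/forallP/(_ t)/implyP; exact.
have inC (s : {set 'I_m}) : clique (skel1 K) s -> s \in clique_complex (skel1 K) finset.setT.
  by move=> cs; rewrite inE cs finset.subsetT.
have edge x y (s : {set 'I_m}) : s \in K -> x \in s -> y \in s -> [set x; y]%SET \in K.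
  move=> sK xs ys; apply: Kd sK _; apply/fintype.subsetP => z.
  by rewrite !inE => /orP[/eqP->|/eqP->].
have KC : K \subset clique_complex (skel1 K) finset.setT.
  apply/fintype.subsetP => s sK; apply: inC; apply/cliqueP => x y xs ys xy.
  by rewrite /skel1 xy (edge x y s).
apply: minF => //; apply/andP; split.
  apply/and3P; split.
  - exact: (fintype.subsetP KC).
  - by apply/forallP => v; exact: set1_clique_complex.
  - apply/forall_inP => s sC; apply/forallP => t; apply/implyP => ts.
    exact: clique_complex_down_closed sC ts.
apply/forallP => s; apply/implyP => /forall_inP sC; apply: inC.
apply/cliqueP => x y xs ys xy.
move: (sC x xs) => /forall_inP/(_ y ys); rewrite xy /= /skel1 xy /=.
by rewrite inE => /andP[/cliqueP/(_ x y)]; rewrite !inE !eqxx orbT => /(_ isT isT xy) /andP[].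
Qed.

Theorem corollary6p6 (R : realType) (m : nat) (K : {set {set 'I_m}})
    (Y : 'I_m -> ptopologicalType)
    (cwY : forall i : 'I_m, pointed_cw_structure R (Y i)) :
  simplicial_complex K ->
  chordal (skel1 K) ->
  has_right_homotopy_inverse R
    (pp_incl (R := R) (Y := Y) (flagification_sup K)).
Proof.
move=> cK chK; have KF := flagification_sup K.
(* The discrete complex on the vertices. *)
have C0K : clique_complex (skel1 K) finset.set0 \subset K.
  case/and3P: cK => K0 /forallP K1 _; apply/fintype.subsetP => s.
  rewrite inE => /andP[_ s1]; have {s1} : (#|s| <= 1)%N.
    by case/orP: s1 => //; rewrite finset.subset0 => /eqP ->; rewrite cards0.
  rewrite leq_eqVlt ltnS leqn0 => /orP[/cards1P[v ->]//|].
  by rewrite cards_eq0 => /eqP ->.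
have C0F : clique_complex (skel1 K) finset.set0 \subset flagification K.
  exact: fintype.subset_trans C0K KF.
apply: (has_right_homotopy_inverse_factor (@pp_incl_continuous R m Y _ _ C0K)).
rewrite -(pp_incl_comp R Y C0K (flagification_sup K) C0F).
move: (C0F); rewrite (flagification_clique_complex cK) => C0C.
apply: clique_complex_right_inverse => //.
- by move=> i; exact: pointed_cw_well_pointed.
- by move=> x y; rewrite /skel1 eq_sym finset.setUC.
- by move=> x; rewrite /skel1 eqxx.
Qed.
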